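(* Let $(\nu)$ be a strictly increasing sequence of real numbers, let $c(\nu)$ be complex numbers indexed by these frequencies, and suppose that the series $S(t)=\sum_{\nu} c(\nu)e(\nu t)$ is absolutely convergent, i.e. $\sum_\nu |c(\nu)|<\infty$. Let $T>0$ and $\delta=\theta/T$ with $\theta\in(0,1)$. Then $$\int_{-T}^{T}|S(t)|^2\,dt\ \ll_{\theta}\ \delta^{-2}\int_{\mathbb{R}}\Big|\sum_{|\nu-x|\le\delta}\Big(1-\frac{|\nu-x|}{\delta}\Big)c(\nu)\Big|^2dx .$$ That is, for every $\theta\in(0,1)$ there is a constant $C(\theta)>0$, depending only on $\theta$, such that for all such $S$ and all $T>0$ the left-hand side is at most $C(\theta)$ times the right-hand side expression.
   Context: $e(x)=e^{2\pi i x}$ for real $x$. The notation $A\ll_\theta B$ means $|A|\le C B$ for a constant $C>0$ depending only on $\theta$. The inner sum on the right is over those frequencies $\nu$ of the given sequence with $|\nu-x|\le\delta$. *)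

(* Defs.v *)
From mathcomp Require Import all_boot all_order all_algebra complex.
From mathcomp Require Import all_classical all_reals all_analysis.
Import Order.TTheory GRing.Theory Num.Theory.
Import numFieldNormedType.Exports.

Set Implicit Arguments.
Unset Strict Implicit.
Unset Printing Implicit Defensive.

Local Open Scope classical_set_scope.
Local Open Scope ring_scope.
Local Open Scope complex_scope.

(* R[i] itself carries no canonical topology; its regular module R[i]^o has
   the one given by the modulus, and limits are taken there.  [cabs] is the
   modulus with values in R, the norm `|z| of R[i] being an element of R[i]. *)
Definition cabs (R : realType) (z : R[i]) : R := ComplexField.Normc.normc z.

Definition e (R : realType) (x : R) : R[i] :=
  cos (2 * pi * x) +i* sin (2 * pi * x).

(* The frequencies form a sequence nu and c k is the coefficient c(nu k). *)
Definition expSum (R : realType) (nu : nat -> R) (c : nat -> R[i]) (t : R) :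
    R[i] :=
  limn ((fun n => \sum_(0 <= k < n) c k * e (nu k * t)) : nat -> R[i]^o).

Definition fejerSum (R : realType) (nu : nat -> R) (c : nat -> R[i])
    (delta x : R) : R[i] :=
  limn ((fun n => \sum_(0 <= k < n | `|nu k - x| <= delta)
    (1 - `|nu k - x| / delta)%:C * c k) : nat -> R[i]^o).

(* Main.v *)
Require Import Defs.
From mathcomp Require Import all_boot all_order all_algebra complex.
From mathcomp Require Import all_classical all_reals all_analysis.
From mathcomp Require Import ring lra measurable_realfun.
Import Order.TTheory GRing.Theory Num.Theory.
Import numFieldNormedType.Exports.
Local Open Scope classical_set_scope.
Local Open Scope ring_scope.

(* The inner sum F(x) = \sum_k c_k tent(nu_k - x) has Fourier transform
   S(t) kappa(t), where kappa, the transform of the tent, is a Fejer kernel and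
   satisfies kappa(t) >= delta cos(pi theta / 2)^4 for |t| <= T.  Only half of
   Plancherel's theorem is needed.  For a finite sum, F is supported in some
   [-L, L], and Bessel's inequality for the orthogonal exponentials of
   frequencies - T + i h + s, where h = 1 / (2 L), bounds
   \sum_i |S kappa|^2 (- T + i h + s) by 2 L \int |F|^2; averaging over s in
   (0, h) turns the sum into the integral over [- T, T].  Absolutely convergent
   sums follow by dominated convergence on both sides. *)

(** * Continuity closure rules and calculus for integrals over segments *)

Section IntegralContinuous.
Context {R : realType}.
Implicit Types f g F : R -> R.
Notation mu := (@lebesgue_measure R).

Lemma continuous_fun_id : continuous (fun x : R => x).
Proof. by move=> x; exact: cvg_id. Qed.

Lemma continuous_fun_cst (k : R) : continuous (fun _ : R => k).
Proof. by move=> x; exact: cvg_cst. Qed.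

Lemma continuous_funD f g : continuous f -> continuous g ->
  continuous (fun x => f x + g x).
Proof. by move=> cf cg x; apply: cvgD; [exact: cf|exact: cg]. Qed.

Lemma continuous_funN f : continuous f -> continuous (fun x => - f x).
Proof. by move=> cf x; apply: cvgN; exact: cf. Qed.

Lemma continuous_funM f g : continuous f -> continuous g ->
  continuous (fun x => f x * g x).
Proof. by move=> cf cg x; apply: cvgM; [exact: cf|exact: cg]. Qed.

Lemma continuous_fun_norm f : continuous f -> continuous (fun x => `|f x|).
Proof. by move=> cf x; apply: cvg_norm; exact: cf. Qed.

Lemma continuous_fun_cos f : continuous f -> continuous (fun x => cos (f x)).
Proof. by move=> cf x; apply: continuous_comp; [exact: cf|exact: continuous_cos]. Qed.

Lemma continuous_fun_sin f : continuous f -> continuous (fun x => sin (f x)).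
Proof. by move=> cf x; apply: continuous_comp; [exact: cf|exact: continuous_sin]. Qed.

Lemma continuous_fun_sqr f : continuous f -> continuous (fun x => f x ^+ 2).
Proof. by move=> cf; exact: (continuous_funM _ _ cf cf). Qed.

Lemma continuous_sum n (f : 'I_n -> R -> R) :
  (forall i, continuous (f i)) -> continuous (fun x => \sum_(i < n) f i x).
Proof.
elim: n f => [|n IH] f cf.
  under eq_fun do rewrite big_ord0.
  exact: continuous_fun_cst.
under eq_fun do rewrite big_ord_recr.
by apply: continuous_funD; [exact: IH|exact: cf].
Qed.

Lemma integrable_segment f a b :
  continuous f -> mu.-integrable `[a, b] (EFin \o f).
Proof.
move=> cf; apply: continuous_compact_integrable; first exact: segment_compact.
exact: continuous_subspaceT.
Qed.

Lemma eq_Rintegral_segment f g (a b : R) :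
  (forall x, a <= x -> x <= b -> f x = g x) ->
  \int[mu]_(x in `[a, b]) f x = \int[mu]_(x in `[a, b]) g x.
Proof.
move=> fg; apply: eq_Rintegral => x.
by rewrite inE/= in_itv/= => /andP[]; exact: fg.
Qed.

Lemma Rintegral_segmentD f g a b : continuous f -> continuous g ->
  \int[mu]_(x in `[a, b]) (f x + g x) =
  \int[mu]_(x in `[a, b]) f x + \int[mu]_(x in `[a, b]) g x.
Proof. by move=> cf cg; apply: RintegralD => //; exact: integrable_segment. Qed.

Lemma Rintegral_segmentZ k f a b : continuous f ->
  \int[mu]_(x in `[a, b]) (k * f x) = k * \int[mu]_(x in `[a, b]) f x.
Proof. by move=> cf; apply: RintegralZl => //; exact: integrable_segment. Qed.

Lemma Rintegral_segment_sum n (f : 'I_n -> R -> R) a b :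
  (forall i, continuous (f i)) ->
  \int[mu]_(x in `[a, b]) (\sum_(i < n) f i x) =
  \sum_(i < n) \int[mu]_(x in `[a, b]) f i x.
Proof.
elim: n f => [|n IH] f cf.
  rewrite big_ord0 (_ : (fun _ => _) = cst 0).
    by rewrite Rintegral_cst// mul0r.
  by apply/funext => x; rewrite big_ord0.
rewrite big_ord_recr/= -IH// -Rintegral_segmentD//; last exact: continuous_sum.
by apply: eq_Rintegral => x _; rewrite big_ord_recr.
Qed.

Lemma Rintegral_FTC2 f F (a b : R) : a <= b -> continuous f ->
  (forall x : R, is_derive x 1 F (f x)) ->
  \int[mu]_(x in `[a, b]) f x = F b - F a.
Proof.
rewrite le_eqVlt => /predU1P[->|ab] cf dF.
  by rewrite set_itv1 Rintegral_set1 subrr.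
have cF : continuous F.
  move=> x; apply/differentiable_continuous/derivable1_diffP.
  exact: (@ex_derive _ _ _ _ _ _ _ (dF x)).
rewrite /Rintegral (continuous_FTC2 (F := F) ab).
- by [].
- exact: continuous_subspaceT.
- split.
  + by move=> x _; exact: (@ex_derive _ _ _ _ _ _ _ (dF x)).
  + exact/cvg_at_right_filter/cF.
  + exact/cvg_at_left_filter/cF.
- by move=> x _; rewrite derive1E; exact: (@derive_val _ _ _ _ _ _ _ (dF x)).
Qed.

Lemma Rintegral_segment_split f (a b c : R) : continuous f -> a <= c -> c <= b ->
  \int[mu]_(x in `[a, b]) f x =
  \int[mu]_(x in `[a, c]) f x + \int[mu]_(x in `[c, b]) f x.
Proof.
move=> cf ac cb.
have := @Rintegral_itvB R f (BLeft a) (BRight b) c (integrable_segment f a b cf).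
rewrite !bnd_simp => /(_ ac cb) /eqP; rewrite subr_eq => /eqP ->.
rewrite addrC; congr (_ + _).
rewrite Rintegral_itv_obnd_cbnd//.
by apply: integrableS (integrable_segment f c b cf) => //; apply: subset_itv_oc_cc.
Qed.

End IntegralContinuous.

(** Recursion on the syntax of the function body. The first three branches catch eta-reduced
    functions; the leaves are constants, continuity hypotheses from the context and the identity. *)
Ltac continuity :=
  lazymatch goal with
  | |- forall x, @continuous_at _ _ x ?f =>
    lazymatch f with
    | @Algebra.opp _ => exact: (continuous_funN _ continuous_fun_id)
    | @cos _ => exact: continuous_cos
    | @sin _ => exact: continuous_sin
    | fun y => @Algebra.opp _ (@?g y) =>
      apply: (continuous_funN g); continuity
    | fun y => @Algebra.add _ (@?g y) (@?h y) =>
      apply: (continuous_funD g h); continuity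
    | fun y => @GRing.mul _ (@?g y) (@?h y) =>
      apply: (continuous_funM g h); continuity
    | fun y => @GRing.exp _ (@?g y) 2 =>
      apply: (continuous_fun_sqr g); continuity
    | fun y => @Num.norm _ _ (@?g y) =>
      apply: (continuous_fun_norm g); continuity
    | fun y => cos (@?g y) => apply: (continuous_fun_cos g); continuity
    | fun y => sin (@?g y) => apply: (continuous_fun_sin g); continuity
    | fun y => \sum_(i < _) (@?g y i) =>
      apply: continuous_sum => ? /=; continuity
    | _ => first [exact: continuous_fun_cst | assumption | exact: continuous_fun_id]
    end
  end.

(** * Integrals against the tent function *)

Section Tent.
Context {R : realType}.
Notation mu := (@lebesgue_measure R).

Definition tent (d x : R) : R := if `|x| <= d then 1 - `|x| / d else 0.

Lemma tent_ge0 (d x : R) : 0 < d -> 0 <= tent d x.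
Proof.
by move=> d0; rewrite /tent; case: ifP => // h; rewrite subr_ge0 ler_pdivrMr ?mul1r.
Qed.

Lemma tent_le1 (d x : R) : 0 < d -> tent d x <= 1.
Proof.
move=> d0; rewrite /tent; case: ifP => // h.
by rewrite lerBlDr lerDl divr_ge0// ltW.
Qed.

(* As a second difference of the absolute value, the tent turns an integral
   against it into a second difference of a double antiderivative. *)
Lemma tentE d x : 0 < d ->
  tent d x = (2 * d)^-1 * (`|x - d| + -2 * `|x| + `|x + d|).
Proof.
move=> d0; rewrite /tent; case: ifPn => h.
  move: h; rewrite ler_norml => /andP[h1 h2].
  rewrite (ler0_norm (x := x - d)) ?subr_le0// (ger0_norm (x := x + d)); last lra.
  field; exact: lt0r_neq0.
rewrite -ltNge in h.
case: (lerP 0 x) => x0.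
  rewrite ger0_norm// in h; rewrite !ger0_norm//; lra.
rewrite ltr0_norm// in h; rewrite !ltr0_norm//; lra.
Qed.

(** Splitting at the kink [p] removes the absolute value, and integration by parts gives a primitive
    on each side. Apart from [2 * E p], the result is affine in [p], so a second difference in [p]
    will remove it. *)
Lemma Rintegral_absB (g D E : R -> R) (p L : R) : `|p| <= L -> continuous g ->
  (forall x : R, is_derive x 1 D (g x)) -> (forall x : R, is_derive x 1 E (D x)) ->
  \int[mu]_(x in `[- L, L]) (`|p - x| * g x) =
  2 * E p - (p + L) * D (- L) - E (- L) + (L - p) * D L - E L.
Proof.
rewrite ler_norml => /andP[p1 p2] cg dD dE.
rewrite (Rintegral_segment_split _ _ _ p)//; last by continuity.
rewrite (eq_Rintegral_segment _ (fun x => (p - x) * g x)); last first.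
  by move=> x _ xp; rewrite ger0_norm// subr_ge0.
rewrite [X in _ + X](eq_Rintegral_segment _ (fun x => (x - p) * g x)); last first.
  by move=> x xp _; rewrite distrC ger0_norm// subr_ge0.
have dl (x : R) : is_derive x 1 (fun x => (p - x) * D x + E x) ((p - x) * g x).
  by apply: is_derive_eq; rewrite /GRing.scale/=; ring.
have dr (x : R) : is_derive x 1 (fun x => (x - p) * D x - E x) ((x - p) * g x).
  by apply: is_derive_eq; rewrite /GRing.scale/=; ring.
rewrite (Rintegral_FTC2 _ _ _ _ p1 _ dl); last by continuity.
rewrite (Rintegral_FTC2 _ _ _ _ p2 _ dr); last by continuity.
ring.
Qed.

Lemma continuous_tent d p : 0 < d -> continuous (fun x => tent d (p - x)).
Proof.
move=> d0.
rewrite (_ : (fun _ => _) = (fun x => (2 * d)^-1 *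
   (`|(p - d) - x| + -2 * `|p - x| + `|(p + d) - x|))); last first.
  by apply/funext => x; rewrite tentE// (addrAC p) (addrAC p _ d).
by continuity.
Qed.

(** The bound on [p] puts the three kinks [p - d], [p] and [p + d] inside the segment. In the second
    difference of [Rintegral_absB] the boundary terms cancel, leaving only values of the double
    primitive [E]. *)
Lemma Rintegral_tent (g D E : R -> R) (d p L : R) :
  0 < d -> `|p| + d <= L -> continuous g ->
  (forall x : R, is_derive x 1 D (g x)) -> (forall x : R, is_derive x 1 E (D x)) ->
  \int[mu]_(x in `[- L, L]) (tent d (p - x) * g x) =
  (E (p + d) - 2 * E p + E (p - d)) / d.
Proof.
move=> d0 pL cg dD dE.
rewrite (eq_Rintegral_segment _ (fun x => (2 * d)^-1 *
   (`|(p - d) - x| * g x + (-2 * (`|p - x| * g x) + `|(p + d) - x| * g x)))); last first.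
  move=> x _ _; rewrite tentE// (addrAC p) (addrAC p _ d); ring.
rewrite Rintegral_segmentZ; last by continuity.
rewrite Rintegral_segmentD; [|by continuity..].
rewrite Rintegral_segmentD; [|by continuity..].
rewrite Rintegral_segmentZ; last by continuity.
rewrite !(Rintegral_absB g D E)//.
- field; exact: lt0r_neq0.
- by rewrite (le_trans (ler_normD _ _))// [`|d|]gtr0_norm.
- by apply: le_trans pL; rewrite lerDl ltW.
- by rewrite (le_trans (ler_normB _ _))// [`|d|]gtr0_norm.
Qed.

End Tent.

(** * Transform of the tent, and Bessel's inequality on a segment *)

Section Bessel.
Context {R : realType}.
Notation mu := (@lebesgue_measure R).

(* The Fourier transform of [tent d] at the angular frequency u = 2 pi t; the
   formula is only meaningful for u != 0, the division giving 0 at u = 0. *)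
Definition fejer_kernel (d u : R) : R := 2 * (1 - cos (u * d)) / (u ^+ 2 * d).

(** A trigonometric function of frequency [u] is an eigenfunction of the second difference with step
    [d], with eigenvalue [2 * (cos (u * d) - 1)]. Its double primitive contributes the factor
    [- 1 / u ^+ 2], whence the kernel. *)
Lemma Rintegral_tent_trig (a b d p L u : R) :
  0 < d -> `|p| + d <= L -> u != 0 ->
  \int[mu]_(x in `[- L, L])
    (tent d (p - x) * (a * cos (u * x) - b * sin (u * x))) =
  fejer_kernel d u * (a * cos (u * p) - b * sin (u * p)).
Proof.
move=> d0 pL u0.
pose D x := (a * sin (u * x) + b * cos (u * x)) / u.
pose E x := - (a * cos (u * x) - b * sin (u * x)) / u ^+ 2.
have dD (x : R) : is_derive x 1 D (a * cos (u * x) - b * sin (u * x)).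
  by apply: is_derive_eq; rewrite /GRing.scale/=; field.
have dE (x : R) : is_derive x 1 E (D x).
  by apply: is_derive_eq; rewrite /GRing.scale/= /D; field.
rewrite (Rintegral_tent _ _ _ d p L d0 pL _ dD dE); last by continuity.
rewrite /E /fejer_kernel !mulrDr mulrN !cosD !sinD cosN sinN.
by field; rewrite u0 lt0r_neq0.
Qed.

Lemma Rintegral_cos_period (u L : R) : 0 < L -> u != 0 -> sin (u * L) = 0 ->
  \int[mu]_(x in `[- L, L]) cos (u * x) = 0.
Proof.
move=> L0 u0 sL.
have dF (x : R) : is_derive x 1 (fun x => sin (u * x) / u) (cos (u * x)).
  by apply: is_derive_eq; rewrite /GRing.scale/=; field.
have LL : - L <= L by lra.
rewrite (Rintegral_FTC2 _ _ _ _ LL _ dF); last by continuity.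
by rewrite mulrN sinN sL; ring.
Qed.

Lemma Rintegral_sin_sym (u L : R) : 0 < L ->
  \int[mu]_(x in `[- L, L]) sin (u * x) = 0.
Proof.
move=> L0; have [->|u0] := eqVneq u 0.
  under eq_Rintegral do rewrite mul0r sin0.
  by rewrite Rintegral_cst// mul0r.
have dF (x : R) : is_derive x 1 (fun x => - cos (u * x) / u) (sin (u * x)).
  by apply: is_derive_eq; rewrite /GRing.scale/=; field.
have LL : - L <= L by lra.
rewrite (Rintegral_FTC2 _ _ _ _ LL _ dF); last by continuity.
by rewrite mulrN cosN; ring.
Qed.

Lemma Rintegral_cst_sym (k L : R) : 0 < L ->
  \int[mu]_(x in `[- L, L]) k = 2 * L * k.
Proof.
move=> L0.
have dF (x : R) : is_derive x 1 (fun x => k * x) k.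
  by apply: is_derive_eq; rewrite /GRing.scale/=; ring.
have LL : - L <= L by lra.
rewrite (Rintegral_FTC2 _ _ _ _ LL _ dF); last by continuity.
ring.
Qed.

(** The complex function F + iG is tested against exp(i u_i x), written in real and imaginary parts.
    The condition on sines says that these exponentials are orthogonal on [-L, L], each with squared
    norm 2L. *)
Lemma bessel_ineq (F G : R -> R) (L : R) N (u : 'I_N -> R) :
  0 < L -> continuous F -> continuous G ->
  (forall i j, i != j -> u i != u j /\ sin ((u i - u j) * L) = 0) ->
  \sum_(i < N)
    ((\int[mu]_(x in `[- L, L]) (F x * cos (u i * x) - G x * sin (u i * x))) ^+ 2
   + (\int[mu]_(x in `[- L, L]) (F x * sin (u i * x) + G x * cos (u i * x))) ^+ 2)
  <= 2 * L * \int[mu]_(x in `[- L, L]) (F x ^+ 2 + G x ^+ 2).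
Proof.
move=> L0 cF cG orth.
set p := fun i => \int[mu]_(x in `[- L, L]) (F x * cos (u i * x) - G x * sin (u i * x)).
set q := fun i => \int[mu]_(x in `[- L, L]) (F x * sin (u i * x) + G x * cos (u i * x)).
rewrite -[leLHS]/(\sum_(i < N) (p i ^+ 2 + q i ^+ 2)).
set Q := \sum_(i < N) _.
(* A + iB is the sum of (p_i + i q_i) exp(- i u_i x), that is, 2L times the orthogonal projection of
   F + iG. The inequality follows by expanding the squared norm of 2L (F + iG) - (A + iB). *)
pose A x := \sum_(i < N) (p i * cos (u i * x) + q i * sin (u i * x)).
pose B x := \sum_(i < N) (q i * cos (u i * x) - p i * sin (u i * x)).
have cA : continuous A by rewrite /A; continuity.
have cB : continuous B by rewrite /B; continuity.
have IFA : \int[mu]_(x in `[- L, L]) (F x * A x + G x * B x) = Q.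
  rewrite (eq_Rintegral_segment _ (fun x => \sum_(i < N)
    (p i * (F x * cos (u i * x) - G x * sin (u i * x)) +
     q i * (F x * sin (u i * x) + G x * cos (u i * x))))); last first.
    move=> x _ _; rewrite /A /B !mulr_sumr -big_split/=.
    by apply: eq_bigr => i _; ring.
  rewrite Rintegral_segment_sum; last by move=> i; continuity.
  apply: eq_bigr => i _.
  rewrite Rintegral_segmentD; [|by continuity..].
  rewrite !Rintegral_segmentZ; [|by continuity..].
  by rewrite -/(p i) -/(q i) !expr2.
have IAA : \int[mu]_(x in `[- L, L]) (A x ^+ 2 + B x ^+ 2) = 2 * L * Q.
  rewrite (eq_Rintegral_segment _ (fun x => \sum_(i < N) \sum_(j < N)
    ((p i * p j + q i * q j) * cos ((u i - u j) * x) +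
     (q i * p j - p i * q j) * sin ((u i - u j) * x)))); last first.
    move=> x _ _; rewrite /A /B !expr2 !big_distrlr/= -big_split/=.
    apply: eq_bigr => i _; rewrite -big_split/=; apply: eq_bigr => j _.
    by rewrite (mulrBl x (u i)) cosB sinB; ring.
  rewrite Rintegral_segment_sum; last by move=> i; continuity.
  rewrite mulr_sumr; apply: eq_bigr => i _.
  rewrite Rintegral_segment_sum; last by move=> j; continuity.
  (* Only the diagonal survives: off it, the cosine integrates to 0 by orthogonality and the sine by
     oddness. *)
  rewrite (bigD1 i)//= big1 ?addr0 => [|j ji].
    rewrite (eq_Rintegral_segment _ (fun=> p i ^+ 2 + q i ^+ 2)); last first.
      by move=> x _ _; rewrite subrr mul0r cos0 sin0; ring.
    by rewrite Rintegral_cst_sym.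
  have [|uij sL] := orth i j; first by rewrite eq_sym.
  rewrite Rintegral_segmentD; [|by continuity..].
  rewrite !Rintegral_segmentZ; [|by continuity..].
  by rewrite Rintegral_cos_period ?subr_eq0// Rintegral_sin_sym//; ring.
have : 0 <= \int[mu]_(x in `[- L, L])
    ((2 * L * F x - A x) ^+ 2 + (2 * L * G x - B x) ^+ 2).
  by apply: Rintegral_ge0 => x _; rewrite addr_ge0// sqr_ge0.
rewrite (eq_Rintegral_segment _ (fun x =>
  (2 * L) ^+ 2 * (F x ^+ 2 + G x ^+ 2) +
  (- (4 * L) * (F x * A x + G x * B x) + (A x ^+ 2 + B x ^+ 2)))); last first.
  by move=> x _ _; ring.
rewrite Rintegral_segmentD; [|by continuity..].
rewrite Rintegral_segmentD; [|by continuity..].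
rewrite !Rintegral_segmentZ; [|by continuity..].
rewrite IFA IAA; set J := \int[mu]_(x in _) _ => h.
have L2 : 0 < 2 * L by rewrite mulr_gt0.
rewrite -(ler_pM2l L2) -subr_ge0; apply: le_trans h _.
by rewrite le_eqVlt; apply/orP; left; apply/eqP; ring.
Qed.

End Bessel.

(** * Lower bound for the Fejer kernel *)

Section KernelBound.
Context {R : realType}.

(** By the mean value theorem sin w = w cos c with c in [0, w], and cosine decreases on [0, pi]. *)
Lemma mul_cos_le_sin (w : R) : 0 <= w -> w <= pi -> w * cos w <= sin w.
Proof.
move=> w0 wpi.
have dsin (x : R) : x \in `]0, w[ -> is_derive x 1 (@sin R) (cos x) by move=> _; apply: is_derive_sin.
have cs : {within `[0, w], continuous (@sin R)}.
  by apply: continuous_subspaceT; exact: continuous_sin.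
have [c cw] := MVT_segment w0 dsin cs.
rewrite sin0 !subr0 mulrC => ->.
move: cw; rewrite in_itv/= => /andP[c0 cw].
apply: ler_wpM2l => //.
by rewrite leNgt ltr_cos -?leNgt// in_itv/= ?c0 ?w0//= (le_trans cw).
Qed.

Lemma le_fejer_kernel (d u theta : R) :
  0 < d -> 0 < theta -> theta < 1 -> u != 0 -> `|u| * d <= 2 * pi * theta ->
  d * cos (pi * theta / 2) ^+ 4 <= fejer_kernel d u.
Proof.
move=> d0 t0 t1 u0 ud.
have pi0 := pi_gt0 R.
have -> : fejer_kernel d u = fejer_kernel d `|u|.
  rewrite /fejer_kernel; case: (ger0P u) => // _.
  by rewrite mulNr cosN sqrrN.
have {}u0 : 0 < `|u| by rewrite normr_gt0.
move: (`|u|) u0 ud => {}u u0 ud.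
(* The kernel is d (sin v / v)^2 with v = 2w, and v may come close to pi, where cos v < 0 makes the
   bound sin v / v >= cos v useless. Halving the angle, sin v / v = (sin w / w) cos w >= (cos w)^2
   with w < pi / 2, which accounts for the fourth power. *)
pose w := u * d / 4.
have w0 : 0 < w by rewrite /w !mulr_gt0.
have wt : w <= pi * theta / 2 by rewrite /w; lra.
have tp : pi * theta < pi by rewrite gtr_pMr.
have wpi : w <= pi by lra.
have -> : fejer_kernel d u = d * (sin w * cos w / w) ^+ 2.
  rewrite /fejer_kernel (_ : u * d = (w *+ 2) *+ 2); last first.
    by rewrite /w; field.
  rewrite cos_mulr2n cos2sin2 sin_mulr2n /w; field.
  by rewrite !gt_eqF.
have c0 : 0 < cos (pi * theta / 2).
  by apply: cos_gt0_pihalf; apply/andP; split; nra.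
have cw : cos (pi * theta / 2) <= cos w.
  have ptpi : pi * theta / 2 <= pi by lra.
  rewrite leNgt ltr_cos -?leNgt// in_itv/= ?(ltW w0)//= ptpi andbT.
  by lra.
rewrite ler_pM2l// (_ : 4 = 2 * 2)%N// exprM lerXn2r// ?nnegrE ?sqr_ge0//.
  rewrite !mulr_ge0 ?invr_ge0 ?(ltW w0)//.
    by rewrite sin_ge0_pi// (ltW w0).
  by rewrite (le_trans _ cw)// ltW.
rewrite ler_pdivlMr// expr2.
have h := mul_cos_le_sin w (ltW w0) wpi.
have cw0 : 0 < cos w by exact: lt_le_trans cw.
apply: (@le_trans _ _ (w * cos w * cos w)); last by rewrite ler_pM2r.
rewrite -[leRHS]mulrA [leLHS]mulrC ler_pM2l//.
by apply: ler_pM => //; exact: ltW.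
Qed.

End KernelBound.

(** * The discrete inequality for finite sums *)

Section FiniteGallagher.
Context {R : realType}.
Notation mu := (@lebesgue_measure R).
Implicit Types (a b nu : nat -> R) (n : nat).

Definition tent_sum n a nu (d x : R) : R := \sum_(k < n) a k * tent d (nu k - x).

(* The real part of \sum_k (a k + i b k) exp(i u nu_k); the imaginary part is
   obtained by replacing (a, b) with (b, - a). *)
Definition trig_sum n a b nu (u : R) : R :=
  \sum_(k < n) (a k * cos (u * nu k) - b k * sin (u * nu k)).

Definition trig_sqr n a b nu (t : R) : R :=
  trig_sum n a b nu (2 * pi * t) ^+ 2 +
  trig_sum n b (fun k => - a k) nu (2 * pi * t) ^+ 2.

Lemma continuous_tent_sum n a nu d : 0 < d -> continuous (tent_sum n a nu d).
Proof.
move=> d0; apply: continuous_sum => i.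
by apply: continuous_funM; [exact: continuous_fun_cst|exact: continuous_tent].
Qed.

Lemma continuous_trig_sqr n a b nu : continuous (trig_sqr n a b nu).
Proof. by rewrite /trig_sqr /trig_sum; continuity. Qed.

Lemma Rintegral_tent_sum_trig n a b nu (d L u : R) :
  0 < d -> (forall k, (k < n)%N -> `|nu k| + d <= L) -> u != 0 ->
  \int[mu]_(x in `[- L, L])
    (tent_sum n a nu d x * cos (u * x) - tent_sum n b nu d x * sin (u * x)) =
  fejer_kernel d u * trig_sum n a b nu u.
Proof.
move=> d0 nuL u0.
rewrite (eq_Rintegral_segment _ (fun x => \sum_(k < n)
   tent d (nu k - x) * (a k * cos (u * x) - b k * sin (u * x)))); last first.
  move=> x _ _; rewrite /tent_sum !mulr_suml -sumrN -big_split/=.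
  by apply: eq_bigr => k _; ring.
have ct (k : 'I_n) : continuous (fun x => tent d (nu k - x)).
  exact: continuous_tent.
rewrite Rintegral_segment_sum; last first.
  move=> k; apply: continuous_funM; first exact: ct.
  by continuity.
rewrite /trig_sum mulr_sumr; apply: eq_bigr => k _.
by rewrite Rintegral_tent_trig// nuL.
Qed.

Lemma sin_mulpi_nat m : sin (m%:R * pi : R) = 0.
Proof.
elim: m => [|m IH]; first by rewrite mul0r sin0.
by rewrite -natr1 mulrDl mul1r sinD IH sinpi; ring.
Qed.

(* Since the number of frequencies is even and 0 < s < h, none of them is 0,
   where [fejer_kernel] is not the transform of the tent. *)
Lemma finite_discrete_ineq n a b nu (theta T d L s h : R) M :
  0 < theta -> theta < 1 -> 0 < T -> d = theta / T ->
  (forall k, (k < n)%N -> `|nu k| + d <= L) ->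
  0 < L -> h * (2 * L) = 1 -> h * M%:R = T -> 0 < s -> s < h ->
  (d * cos (pi * theta / 2) ^+ 4) ^+ 2 *
    \sum_(i < M.*2) trig_sqr n a b nu (- T + i%:R * h + s) <=
  2 * L * \int[mu]_(x in `[- L, L])
    (tent_sum n a nu d x ^+ 2 + tent_sum n b nu d x ^+ 2).
Proof.
move=> t0 t1 T0 dT nuL L0 hL hM s0 sh.
have d0 : 0 < d by rewrite dT divr_gt0.
have pi0 := pi_gt0 R.
have h0 : 0 < h by lra.
pose t (i : 'I_(M.*2)) : R := - T + i%:R * h + s.
pose u i := 2 * pi * t i.
have un0 i : u i != 0.
  rewrite !mulf_neq0//; first by rewrite gt_eqF.
  rewrite /t -hM; have [iM|iM] := leqP M i.
    rewrite gt_eqF//; have : M%:R <= i%:R :> R by rewrite ler_nat.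
    by nra.
  rewrite lt_eqF//; have : i%:R + 1 <= M%:R :> R by rewrite natr1 ler_nat.
  by nra.
(* All sampling points lie in [-T, T], since i <= 2M - 1 and s < h, and T d = theta. *)
have ub i : `|u i| * d <= 2 * pi * theta.
  rewrite normrM gtr0_norm ?mulr_gt0// -[leLHS]mulrA ler_pM2l ?mulr_gt0//.
  rewrite dT mulrCA ler_piMr//; first exact: ltW.
  rewrite ler_pdivrMr// mul1r /t ler_norml.
  have i0 : 0 <= i%:R :> R by [].
  have : i%:R + 1 <= M.*2%:R :> R by rewrite natr1 ler_nat.
  have -> : M.*2%:R = M%:R * 2 :> R by rewrite -muln2 natrM.
  by move=> iM; apply/andP; split; nra.
(* The spacing h = 1 / (2L) makes (u_i - u_j) L equal to (i - j) pi. *)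
have orth i j : i != j -> u i != u j /\ sin ((u i - u j) * L) = 0.
  have -> : (u i - u j) * L = (i%:R - j%:R) * pi.
    rewrite /u /t (_ : _ * L = (i%:R - j%:R) * pi * (h * (2 * L))); last by ring.
    by rewrite hL mulr1.
  move=> ij; split.
    apply: contra_neq ij => e.
    have : (i%:R - j%:R) * (2 * pi * h) = 0 :> R.
      have -> : (i%:R - j%:R) * (2 * pi * h) = u i - u j by rewrite /u /t; ring.
      by rewrite e subrr.
    move/eqP; rewrite mulf_eq0 [X in _ || X]gt_eqF ?mulr_gt0// orbF subr_eq0.
    by rewrite eqr_nat => /eqP/val_inj.
  have [ji|ij'] := leqP j i; first by rewrite -natrB// sin_mulpi_nat.
  rewrite -(opprB j%:R) mulNr sinN -natrB; last exact: ltnW.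
  by rewrite sin_mulpi_nat oppr0.
have cF := continuous_tent_sum n a nu d d0.
have cG := continuous_tent_sum n b nu d d0.
have c0 : 0 <= d * cos (pi * theta / 2) ^+ 4.
  rewrite mulr_ge0 ?(ltW d0)// exprn_ge0//.
  by apply: cos_ge0_pihalf; apply/andP; split; nra.
have ck i := le_fejer_kernel d (u i) theta d0 t0 t1 (un0 i) (ub i).
move: c0 ck; set k0 := d * _ ^+ 4 => c0 ck.
apply: le_trans (bessel_ineq _ _ L _ u L0 cF cG orth).
rewrite mulr_sumr; apply: ler_sum => i _.
(* The imaginary part of the transform is the real part for the coefficients (b, - a), that is, for
   c multiplied by - i. *)
have -> : \int[mu]_(x in `[- L, L]) (tent_sum n a nu d x * sin (u i * x)
      + tent_sum n b nu d x * cos (u i * x)) =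
    fejer_kernel d (u i) * trig_sum n b (fun k => - a k) nu (u i).
  rewrite -(Rintegral_tent_sum_trig _ _ _ _ _ L)//.
  apply: eq_Rintegral_segment => x _ _.
  have -> : tent_sum n (fun k => - a k) nu d x = - tent_sum n a nu d x.
    by rewrite /tent_sum -sumrN; apply: eq_bigr => k _; rewrite mulNr.
  by ring.
rewrite Rintegral_tent_sum_trig// /trig_sqr -/(t i) -/(u i).
set P := trig_sum _ _ _ _ _; set Q := trig_sum _ _ _ _ _.
move: (ck i); set k := fejer_kernel _ _ => cki.
have -> : (k * P) ^+ 2 + (k * Q) ^+ 2 = k ^+ 2 * (P ^+ 2 + Q ^+ 2) by ring.
apply: ler_wpM2r; first by rewrite addr_ge0// sqr_ge0.
by apply: lerXn2r; rewrite ?nnegrE ?(le_trans c0).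
Qed.

End FiniteGallagher.

(** * From sampled sums to the integral over [-T, T] *)

Section Translates.
Context {R : realType}.
Notation mu := (@lebesgue_measure R).

(** With F a primitive of W, the sum G(s) of the F(a + ih + s) satisfies G(h) - G(0) = F(a + Nh) -
    F(a) by telescoping. The mean value theorem turns this into h G'(s) at an interior s, so a bound
    on the open interval (0, h) suffices. *)
Lemma Rintegral_le_sum_translates (W : R -> R) (a h K : R) N :
  continuous W -> 0 < h ->
  (forall s, 0 < s -> s < h -> \sum_(i < N) W (a + i%:R * h + s) <= K) ->
  \int[mu]_(t in `[a, a + N%:R * h]) W t <= h * K.
Proof.
move=> cW h0 WK.
have [F dF] : exists F : R -> R,
    (forall x : R, a <= x -> x <= a + N%:R * h -> is_derive x 1 F (W x)) /\
    F (a + N%:R * h) - F a = \int[mu]_(t in `[a, a + N%:R * h]) W t.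
  have N0 : 0 <= N%:R * h by rewrite mulr_ge0// ltW.
  have a1 : a - 1 <= a by lra.
  have aN : a <= a + N%:R * h by lra.
  (* Starting the primitive at [a - 1] makes it differentiable from both sides at the endpoint [a]
     as well. *)
  exists (fun x => \int[mu]_(t in `[a - 1, x]) W t); split=> [x ax xN|].
    have x1 : x < a + N%:R * h + 1 by lra.
    have a1x : a - 1 < x by lra.
    have [d e] := @continuous_FTC1_closed R W (a - 1) x _ x1
      (integrable_segment W _ _ cW) a1x (cW x).
    by apply: DeriveDef => //; rewrite -derive1E.
  by rewrite (Rintegral_segment_split W _ _ a cW a1 aN); ring.
have [{}dF <-] := dF.
pose G (s : R) := \sum_(i < N) F (a + i%:R * h + s).
have dG (s : R) : 0 <= s -> s <= h ->
    is_derive s 1 G (\sum_(i < N) W (a + i%:R * h + s)).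
  move=> s0 sh.
  have -> : G = \sum_(i < N) (fun s => F (a + i%:R * h + s)).
    by apply/funext => x; rewrite fct_sumE.
  apply: is_derive_sum => i.
  have dFi : is_derive (a + i%:R * h + s) 1 F (W (a + i%:R * h + s)).
    have i0 : 0 <= i%:R * h by rewrite mulr_ge0// ltW.
    have : (i%:R + 1) * h <= N%:R * h by rewrite ler_pM2r// natr1 ler_nat.
    by rewrite mulrDl mul1r => iN; apply: dF; lra.
  have di : is_derive s 1 (fun s => a + i%:R * h + s) 1.
    by apply: is_derive_eq; ring.
  rewrite -[X in is_derive _ _ _ X]mulr1.
  exact: (@is_derive1_comp _ F (fun s => a + i%:R * h + s) s _ _ dFi di).
have cG : {within `[0, h], continuous G}.
  apply: derivable_within_continuous => s; rewrite in_itv/= => /andP[s0 sh].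
  exact: (@ex_derive _ _ _ _ _ _ _ (dG s s0 sh)).
have dG' (s : R) : s \in `]0, h[ ->
    is_derive s 1 G (\sum_(i < N) W (a + i%:R * h + s)).
  by rewrite in_itv/= => /andP[s0 sh]; apply: dG; exact: ltW.
have [s sh Gh] := MVT h0 dG' cG.
have <- : G h - G 0 = F (a + N%:R * h) - F a.
  rewrite -sumrB.
  have := telescope_sumr (fun i => F (a + i%:R * h)) (leq0n N).
  rewrite mul0r addr0 big_mkord => <-; apply: eq_bigr => i _.
  by rewrite addr0 -natr1 mulrDl mul1r addrA.
rewrite Gh subr0 mulrC ler_pM2l//.
by move: sh; rewrite in_itv/= => /andP[s0 sh]; exact: WK.
Qed.

Lemma finite_gallagher n (a b nu : nat -> R) (theta T d : R) :
  0 < theta -> theta < 1 -> 0 < T -> d = theta / T ->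
  exists L : R, \int[mu]_(t in `[- T, T]) trig_sqr n a b nu t <=
    (cos (pi * theta / 2) ^+ 8)^-1 * d ^- 2 *
    \int[mu]_(x in `[- L, L])
      (tent_sum n a nu d x ^+ 2 + tent_sum n b nu d x ^+ 2).
Proof.
move=> t0 t1 T0 dT.
have d0 : 0 < d by rewrite dT divr_gt0.
have pi0 := pi_gt0 R.
pose B := \sum_(k < n) `|nu k| + d.
have B0 : 0 < B by rewrite ltr_wpDl// sumr_ge0.
(* An integer M > 2TB gives L = M / (2T) >= B, enough to contain the supports of all tents, while
   the step h = 1 / (2L) = T / M divides [-T, T] into exactly 2M pieces. *)
pose M := (Num.trunc (2 * T * B)).+1.
have M0 : 0 < M%:R :> R by rewrite ltr0n.
have BM : 2 * T * B < M%:R by exact: truncnS_gt.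
pose L := M%:R / (2 * T).
have L0 : 0 < L by rewrite divr_gt0// mulr_gt0.
have BL : B <= L by rewrite ler_pdivlMr ?mulr_gt0// mulrC ltW.
pose h := T / M%:R.
have h0 : 0 < h by rewrite divr_gt0.
have hL : h * (2 * L) = 1.
  by rewrite /h /L; field; rewrite !gt_eqF.
have hM : h * M%:R = T by rewrite /h; field; rewrite gt_eqF.
have nuL k : (k < n)%N -> `|nu k| + d <= L.
  move=> kn; apply: le_trans BL; rewrite lerD2r.
  by rewrite (bigD1 (Ordinal kn))//= lerDl sumr_ge0.
exists L; set J := \int[mu]_(x in `[- L, L]) _.
pose k0 := d * cos (pi * theta / 2) ^+ 4.
have c0 : 0 < cos (pi * theta / 2).
  by apply: cos_gt0_pihalf; apply/andP; split; nra.
have k00 : 0 < k0 ^+ 2 by rewrite exprn_gt0// mulr_gt0// exprn_gt0.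
have := @Rintegral_le_sum_translates (trig_sqr n a b nu) (- T) h
  (2 * L * J / k0 ^+ 2) M.*2 (continuous_trig_sqr n a b nu) h0.
have -> : - T + M.*2%:R * h = T.
  by rewrite -muln2 natrM -[in RHS]hM -[in LHS]hM; ring.
(* The factor 2L from Bessel's inequality cancels against the step h, so the constant does not
   depend on L. *)
have -> : h * (2 * L * J / k0 ^+ 2) =
    (cos (pi * theta / 2) ^+ 8)^-1 * d ^- 2 * J.
  rewrite (_ : h * _ = h * (2 * L) * (J / k0 ^+ 2)); last by ring.
  rewrite hL /k0; field.
  by rewrite !gt_eqF.
apply => s s0 sh; rewrite ler_pdivlMr// mulrC.
exact: finite_discrete_ineq.
Qed.

End Translates.

(** * Complex limits through real and imaginary parts *)

Section ComplexLimits.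
Local Open Scope complex_scope.
Context {R : realType}.

Lemma cabs_sqrE (z : R[i]) : cabs z ^+ 2 = complex.Re z ^+ 2 + complex.Im z ^+ 2.
Proof. by case: z => x y; rewrite /cabs/= sqr_sqrtr// addr_ge0// sqr_ge0. Qed.

Lemma cabs_ge0 (z : R[i]) : 0 <= cabs z.
Proof. by case: z => x y; rewrite /cabs/= sqrtr_ge0. Qed.

Lemma Re_le_cabs (z : R[i]) : `|complex.Re z| <= cabs z.
Proof.
rewrite -ler_sqr ?nnegrE ?cabs_ge0// cabs_sqrE real_normK ?num_real//.
by rewrite lerDl sqr_ge0.
Qed.

Lemma Im_le_cabs (z : R[i]) : `|complex.Im z| <= cabs z.
Proof.
rewrite -ler_sqr ?nnegrE ?cabs_ge0// cabs_sqrE real_normK ?num_real//.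
by rewrite lerDr sqr_ge0.
Qed.

Lemma Re_sum (I : Type) (r : seq I) (f : I -> R[i]) :
  complex.Re (\sum_(i <- r) f i) = \sum_(i <- r) complex.Re (f i).
Proof.
elim: r => [|i r IH]; first by rewrite !big_nil.
by rewrite !big_cons -IH; case: (f i) => ? ?; case: (\sum_(j <- r) f j).
Qed.

Lemma Im_sum (I : Type) (r : seq I) (f : I -> R[i]) :
  complex.Im (\sum_(i <- r) f i) = \sum_(i <- r) complex.Im (f i).
Proof.
elim: r => [|i r IH]; first by rewrite !big_nil.
by rewrite !big_cons -IH; case: (f i) => ? ?; case: (\sum_(j <- r) f j).
Qed.

Lemma cvg_complex (u : nat -> R[i]) (x y : R) :
  (fun n => complex.Re (u n)) @ \oo --> x ->
  (fun n => complex.Im (u n)) @ \oo --> y ->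
  (u : nat -> R[i]^o) @ \oo --> (x +i* y : R[i]^o).
Proof.
move=> ux uy; apply/cvgrPdist_lt => -[e1 e2].
(* A positive element of [R[i]] has zero imaginary part, so the radius is the real number [e1]. *)
rewrite ltcE/= => /andP[/eqP-> e0].
have e20 : 0 < e1 / 2 by rewrite divr_gt0.
move/cvgrPdist_lt : ux => /(_ _ e20) ux.
move/cvgrPdist_lt : uy => /(_ _ e20) uy.
near=> n.
have hx : `|x - complex.Re (u n)| < e1 / 2 by near: n.
have hy : `|y - complex.Im (u n)| < e1 / 2 by near: n.
rewrite normc_def ltcR.
rewrite -(ger0_norm (ltW e0)) -sqrtr_sqr ltr_sqrt ?exprn_gt0//.
case: (u n) hx hy => p q /=; rewrite !ltr_norml => /andP[? ?] /andP[? ?].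
nra.
Unshelve. all: by end_near. Qed.

(** Both coordinates converge, so [limn] is the genuine limit and not a default value; squaring the
    modulus avoids the square root. *)
Lemma cvg_cabs_sqr_limn (u : nat -> R[i]) :
  cvgn (fun n => complex.Re (u n)) -> cvgn (fun n => complex.Im (u n)) ->
  (fun n => complex.Re (u n) ^+ 2 + complex.Im (u n) ^+ 2) @ \oo -->
  cabs (limn (u : nat -> R[i]^o)) ^+ 2.
Proof.
move=> cx cy.
have h := cvg_complex u _ _ cx cy.
rewrite (cvg_lim (@norm_hausdorff _ R[i]^o) h) cabs_sqrE/=.
by apply: cvgD; rewrite expr2; under eq_fun do rewrite expr2; apply: cvgM.
Qed.

End ComplexLimits.

(** * Dominated real series *)

Section Series.
Context {R : realType}.

Lemma cvg_series_dominated (v w : nat -> R) (K : R) :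
  0 <= K -> (forall k, 0 <= w k) -> (forall k, `|v k| <= K * w k) ->
  cvgn (series w) -> cvgn (series v).
Proof.
move=> K0 w0 vw cw; apply: normed_cvg.
apply: (@series_le_cvg _ _ (fun k => K * w k)) => //.
- by move=> k; exact: normr_ge0.
- by move=> k; exact: mulr_ge0.
- exact: (@is_cvg_seriesZ _ w K).
Qed.

Lemma series_le_limn (w : nat -> R) n :
  (forall k, 0 <= w k) -> cvgn (series w) ->
  \sum_(k < n) w k <= limn (series w).
Proof.
move=> w0 cw; rewrite -[leLHS](big_mkord xpredT).
apply: nondecreasing_cvgn_le => //; exact: nondecreasing_series.
Qed.

End Series.

(** * Pointwise limits and majorants of the partial sums *)

Section Pointwise.
Local Open Scope complex_scope.
Context {R : realType}.
Variables (nu : nat -> R) (c : nat -> R[i]).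
Hypothesis sc : cvgn (series (fun k => cabs (c k))).
Let a k := complex.Re (c k).
Let b k := complex.Im (c k).

Lemma trig_term_le (p q w u x : R) : `|p| <= w -> `|q| <= w ->
  `|p * cos (u * x) - q * sin (u * x)| <= 2 * w.
Proof.
move=> pw qw; apply: le_trans (ler_normB _ _) _.
have w0 : 0 <= w by apply: le_trans pw.
rewrite mulr2n mulrDl mul1r !normrM; apply: lerD.
  by rewrite -[w]mulr1 ler_pM ?cos_max.
by rewrite -[w]mulr1 ler_pM ?sin_max.
Qed.

Lemma cvg_trig_sqr (t : R) :
  (fun n => trig_sqr n a b nu t) @ \oo --> cabs (expSum nu c t) ^+ 2.
Proof.
pose u n := \sum_(0 <= k < n) c k * e (nu k * t).
have Reu n : complex.Re (u n) =
    series (fun k => a k * cos (2 * pi * t * nu k) - b k * sin (2 * pi * t * nu k)) n.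
  rewrite /u Re_sum; apply: eq_bigr => k _.
  by rewrite /a /b /e -!mulrA [t * _]mulrC; case: (c k).
have Imu n : complex.Im (u n) =
    series (fun k => b k * cos (2 * pi * t * nu k) - - a k * sin (2 * pi * t * nu k)) n.
  rewrite /u Im_sum; apply: eq_bigr => k _.
  rewrite /a /b /e -!mulrA [t * _]mulrC; case: (c k) => p q /=.
  by rewrite mulNr opprK addrC.
have -> : (fun n => trig_sqr n a b nu t) =
    (fun n => complex.Re (u n) ^+ 2 + complex.Im (u n) ^+ 2).
  apply/funext => n.
  by rewrite Reu Imu /trig_sqr /trig_sum /series/= !big_mkord.
apply: cvg_cabs_sqr_limn.
  under eq_fun do rewrite Reu.
  apply: (cvg_series_dominated _ (fun k => cabs (c k)) 2) => // k; first exact: cabs_ge0.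
  by apply: trig_term_le; [exact: Re_le_cabs|exact: Im_le_cabs].
under eq_fun do rewrite Imu.
apply: (cvg_series_dominated _ (fun k => cabs (c k)) 2) => // k; first exact: cabs_ge0.
by apply: trig_term_le; rewrite ?normrN; [exact: Im_le_cabs|exact: Re_le_cabs].
Qed.

Lemma cvg_tent_sqr (d x : R) : 0 < d ->
  (fun n => tent_sum n a nu d x ^+ 2 + tent_sum n b nu d x ^+ 2) @ \oo -->
  cabs (fejerSum nu c d x) ^+ 2.
Proof.
move=> d0.
pose u n := \sum_(0 <= k < n | `|nu k - x| <= d) (1 - `|nu k - x| / d)%:C * c k.
have uE n : u n = \sum_(0 <= k < n) (tent d (nu k - x))%:C * c k.
  rewrite /u big_mkcond/=; apply: eq_bigr => k _.
  by rewrite /tent; case: ifP => //; rewrite mul0r.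
have Reu n : complex.Re (u n) = series (fun k => a k * tent d (nu k - x)) n.
  rewrite uE Re_sum; apply: eq_bigr => k _.
  by rewrite /a; case: (c k) => p q /=; ring.
have Imu n : complex.Im (u n) = series (fun k => b k * tent d (nu k - x)) n.
  rewrite uE Im_sum; apply: eq_bigr => k _.
  by rewrite /b; case: (c k) => p q /=; ring.
have bnd (p : R) k : `|p| <= cabs (c k) ->
    `|p * tent d (nu k - x)| <= 1 * cabs (c k).
  move=> pc; rewrite normrM mul1r -[leRHS]mulr1 ler_pM//.
  by rewrite ger0_norm ?tent_ge0// tent_le1.
have -> : (fun n => tent_sum n a nu d x ^+ 2 + tent_sum n b nu d x ^+ 2) =
    (fun n => complex.Re (u n) ^+ 2 + complex.Im (u n) ^+ 2).
  by apply/funext => n; rewrite Reu Imu /tent_sum /series/= !big_mkord.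
apply: cvg_cabs_sqr_limn.
  under eq_fun do rewrite Reu.
  apply: (cvg_series_dominated _ (fun k => cabs (c k)) 1) => // k; first exact: cabs_ge0.
  by apply: bnd; exact: Re_le_cabs.
under eq_fun do rewrite Imu.
apply: (cvg_series_dominated _ (fun k => cabs (c k)) 1) => // k; first exact: cabs_ge0.
by apply: bnd; exact: Im_le_cabs.
Qed.

Let M := limn (series (fun k => cabs (c k))).

(** A majorant uniform in [n]; being constant, it is integrable on the bounded segment [-T, T]. *)
Lemma trig_sqr_le n (t : R) : trig_sqr n a b nu t <= 2 * (2 * M) ^+ 2.
Proof.
have M0 : 0 <= M.
  have := series_le_limn _ 0 (fun k => cabs_ge0 (c k)) sc.
  by rewrite big_ord0.
have h (p q : nat -> R) u : (forall k, `|p k| <= cabs (c k)) ->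
    (forall k, `|q k| <= cabs (c k)) -> trig_sum n p q nu u ^+ 2 <= (2 * M) ^+ 2.
  move=> pc qc; rewrite -real_normK ?num_real// lerXn2r ?nnegrE ?mulr_ge0//.
  rewrite (le_trans (ler_norm_sum _ _ _))//.
  rewrite (@le_trans _ _ (\sum_(k < n) 2 * cabs (c k)))//.
    by apply: ler_sum => k _; exact: trig_term_le.
  by rewrite -mulr_sumr ler_pM2l// series_le_limn// => k; exact: cabs_ge0.
rewrite mulr2n mulrDl mul1r; apply: lerD; apply: h => k; rewrite ?normrN;
  by [exact: Re_le_cabs|exact: Im_le_cabs].
Qed.

(** A constant majorant would not be integrable over the whole line. One factor of each square is
    therefore bounded by [M], while the other is kept as a sum of tents; the 2 counts the two
    coordinates. *)
Lemma tent_sqr_le n (d x : R) : 0 < d ->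
  tent_sum n a nu d x ^+ 2 + tent_sum n b nu d x ^+ 2 <=
  2 * M * \sum_(k < n) cabs (c k) * tent d (nu k - x).
Proof.
move=> d0; set H := \sum_(k < n) _.
have H0 : 0 <= H by apply: sumr_ge0 => k _; rewrite mulr_ge0 ?cabs_ge0 ?tent_ge0.
have HM : H <= M.
  apply: (@le_trans _ _ (\sum_(k < n) cabs (c k))).
    by apply: ler_sum => k _; rewrite ler_piMr ?cabs_ge0 ?tent_le1.
  by apply: series_le_limn => // k; exact: cabs_ge0.
have h (p : nat -> R) : (forall k, `|p k| <= cabs (c k)) ->
    tent_sum n p nu d x ^+ 2 <= M * H.
  move=> pc; have pH : `|tent_sum n p nu d x| <= H.
    rewrite (le_trans (ler_norm_sum _ _ _))//; apply: ler_sum => k _.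
    by rewrite normrM [X in _ * X]ger0_norm ?tent_ge0// ler_wpM2r ?tent_ge0.
  rewrite -real_normK ?num_real// expr2 ler_pM//.
  exact: le_trans pH HM.
rewrite -mulrA mulr2n mulrDl mul1r; apply: lerD; apply: h => k;
  by [exact: Re_le_cabs|exact: Im_le_cabs].
Qed.

End Pointwise.

(** * Integrability of the majorant on the line *)

Section Limits.
Context {R : realType}.
Notation mu := (@lebesgue_measure R).

Lemma measurable_continuous_EFin (f : R -> R) (D : set R) :
  continuous f -> measurable_fun D (EFin \o f).
Proof.
move=> cf; apply/measurable_EFinP.
by apply: measurable_funTS; exact: continuous_measurable_fun.
Qed.

Lemma integral_tent_le (d p : R) : 0 < d ->
  (\int[mu]_x (tent d (p - x))%:E <= (2 * d)%:E)%E.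
Proof.
move=> d0.
apply: (@le_trans _ _ (\int[mu]_x (\1_(`[p - d, p + d] : set R) x)%:E)%E).
  apply: ge0_le_integral => //.
  - by move=> x _; rewrite lee_fin tent_ge0.
  - by apply: measurable_continuous_EFin; exact: continuous_tent.
  - by apply/measurable_EFinP; apply: measurable_indic.
  - move=> x _; rewrite lee_fin indicE.
    case: (boolP (x \in _)) => xpd; first exact: tent_le1.
    rewrite /tent; case: ifPn => // h; exfalso; move/negP: xpd; apply.
    rewrite inE/= in_itv/=.
    by move: h; rewrite ler_norml => /andP[? ?]; apply/andP; split; lra.
rewrite integral_indic//= setIT.
rewrite lebesgue_measure_itv/= lte_fin.
case: ifPn => _; rewrite ?lee_fin; last by rewrite mulr_ge0 ?ltW.
lra.
Qed.

(** All terms being nonnegative, sum and integral may be exchanged; each tent has integral at most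
    2d, so the total is at most 2 K d times the sum of the weights. *)
Lemma integrable_tent_majorant (nu w : nat -> R) (d K : R) :
  0 < d -> 0 <= K -> (forall k, 0 <= w k) -> cvgn (series w) ->
  mu.-integrable setT (fun x =>
    K%:E * \sum_(0 <= k <oo) (w k * tent d (nu k - x))%:E)%E.
Proof.
move=> d0 K0 w0 sw.
have ct k : continuous (fun x => w k * tent d (nu k - x)).
  by apply: continuous_funM; [exact: continuous_fun_cst|exact: continuous_tent].
have mt k : measurable_fun [set: R] (fun x => (w k * tent d (nu k - x))%:E).
  exact: measurable_continuous_EFin (ct k).
have t0 k x : (0 <= (w k * tent d (nu k - x))%:E)%E.
  by rewrite lee_fin mulr_ge0// tent_ge0.
have mg : measurable_fun [set: R]
    (fun x => \sum_(0 <= k <oo) (w k * tent d (nu k - x))%:E)%E.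
  exact: (ge0_emeasurable_sum (P := xpredT)).
have g0 x : (0 <= \sum_(0 <= k <oo) (w k * tent d (nu k - x))%:E)%E.
  by apply: nneseries_ge0 => k _ _; exact: t0.
apply/integrableP; split; first exact: measurable_funeM.
under eq_integral.
  move=> x _; rewrite gee0_abs ?mule_ge0//; over.
rewrite ge0_integralZl// integral_nneseries//.
apply: (@le_lt_trans _ _ (K%:E * (2 * d * limn (series w))%:E)%E); last first.
  by rewrite -EFinM ltry.
apply: lee_wpmul2l; first by rewrite lee_fin.
apply: lime_le.
  apply: (@is_cvg_nneseries _ _ xpredT) => k _ _.
  by apply: (@integral_ge0 _ _ _ mu) => x _; exact: t0.
apply: nearW => n.
apply: (@le_trans _ _ (\sum_(0 <= k < n) (2 * d * w k)%:E)%E).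
  apply: lee_sum => k _.
  under eq_integral do rewrite EFinM.
  rewrite ge0_integralZl//; last 3 first.
  - by apply: measurable_continuous_EFin; exact: continuous_tent.
  - by move=> x _; rewrite lee_fin tent_ge0.
  - by rewrite lee_fin.
  rewrite [X in (_ <= X)%E]EFinM [X in (_ <= X)%E]muleC.
  by apply: lee_wpmul2l; rewrite ?lee_fin//; exact: integral_tent_le.
rewrite sumEFin lee_fin -mulr_sumr ler_wpM2l ?mulr_ge0 ?(ltW d0)//.
by rewrite big_mkord; exact: series_le_limn.
Qed.

Lemma integral_segment_EFin (f : R -> R) (a b : R) : continuous f ->
  (\int[mu]_(x in `[a, b]) (f x)%:E)%E = (\int[mu]_(x in `[a, b]) f x)%:E.
Proof.
move=> cf; rewrite /Rintegral fineK//.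
exact: integrable_fin_num (integrable_segment f a b cf).
Qed.

End Limits.

(** * Passage from finite sums to absolutely convergent series *)

Theorem mainTheorem1 (R : realType) (theta : R) (htheta0 : 0 < theta)
    (htheta1 : theta < 1) :
  exists C : R, 0 < C /\
    forall (nu : nat -> R) (c : nat -> R[i]),
      {homo nu : m n / (m < n)%N >-> m < n} ->
      cvgn (series (fun k => cabs (c k))) ->
      forall T delta : R, 0 < T -> delta = theta / T ->
        (\int[@lebesgue_measure R]_(t in `[(- T)%R, T]) (cabs (expSum nu c t) ^+ 2)%:E
         <= C%:E * ((delta ^- 2)%:E *
              \int[@lebesgue_measure R]_x (cabs (fejerSum nu c delta x) ^+ 2)%:E))%E.
Proof.
have pi0 := pi_gt0 R.
have c0 : 0 < cos (pi * theta / 2).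
  by apply: cos_gt0_pihalf; apply/andP; split; nra.
(* The kernel is at least d cos(pi theta / 2)^4 and enters squared: this is the constant of
   [finite_gallagher]. *)
exists (cos (pi * theta / 2) ^+ 8)^-1; split; first by rewrite invr_gt0 exprn_gt0.
move=> nu c _ sc T d T0 dT.
have d0 : 0 < d by rewrite dT divr_gt0.
set C := _^-1.
pose a k := complex.Re (c k).
pose b k := complex.Im (c k).
pose M := limn (series (fun k => cabs (c k))).
have w0 k := cabs_ge0 (c k).
have M0 : 0 <= M.
  by have := series_le_limn _ 0 w0 sc; rewrite big_ord0.
pose P n (t : R) := trig_sqr n a b nu t.
pose Q n (x : R) := tent_sum n a nu d x ^+ 2 + tent_sum n b nu d x ^+ 2.
have cP n : continuous (P n) by exact: continuous_trig_sqr.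
have cQ n : continuous (Q n).
  by apply: continuous_funD; apply: continuous_fun_sqr; exact: continuous_tent_sum.
have P0 n t : 0 <= P n t by rewrite addr_ge0// sqr_ge0.
have Q0 n x : 0 <= Q n x by rewrite addr_ge0// sqr_ge0.
have limP t : P ^~ t @ \oo --> cabs (expSum nu c t) ^+ 2.
  exact: cvg_trig_sqr.
have limQ x : Q ^~ x @ \oo --> cabs (fejerSum nu c d x) ^+ 2.
  exact: cvg_tent_sqr.
have mP n D : measurable_fun D (EFin \o P n) by exact: measurable_continuous_EFin.
have mQ n D : measurable_fun D (EFin \o Q n) by exact: measurable_continuous_EFin.
(* Both integrands are measurable as pointwise limits of continuous functions. *)
have mS D : measurable_fun D (fun t => (cabs (expSum nu c t) ^+ 2)%:E).
  apply/measurable_EFinP; apply: (measurable_fun_cvg (h := P)) => //.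
  by move=> n; apply/measurable_EFinP.
have mF D : measurable_fun D (fun x => (cabs (fejerSum nu c d x) ^+ 2)%:E).
  apply/measurable_EFinP; apply: (measurable_fun_cvg (h := Q)) => //.
  by move=> n; apply/measurable_EFinP.
have cvgP : (\int[@lebesgue_measure R]_(t in `[(- T)%R, T]) (P n t)%:E)%E @[n --> \oo] -->
    (\int[@lebesgue_measure R]_(t in `[(- T)%R, T]) (cabs (expSum nu c t) ^+ 2)%:E)%E.
  have [|||||_ _ //] := @dominated_convergence _ _ R (@lebesgue_measure R)
    `[- T, T]%classic (measurable_itv _) (fun n t => (P n t)%:E)
    (fun t => (cabs (expSum nu c t) ^+ 2)%:E) (fun=> (2 * (2 * M) ^+ 2)%:E).
  - by move=> n; exact: mP.
  - exact: mS.
  - by apply: aeW => t _; apply: cvg_EFin; [exact: nearW|exact: limP].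
  - exact: (integrable_segment _ (- T) T (continuous_fun_cst (2 * (2 * M) ^+ 2))).
  - by apply: aeW => t n _; rewrite gee0_abs ?lee_fin//; exact: trig_sqr_le.
have cvgQ : (\int[@lebesgue_measure R]_x (Q n x)%:E)%E @[n --> \oo] -->
    (\int[@lebesgue_measure R]_x (cabs (fejerSum nu c d x) ^+ 2)%:E)%E.
  have M20 : 0 <= 2 * M by rewrite mulr_ge0.
  have [|||||_ _ //] := @dominated_convergence _ _ R (@lebesgue_measure R)
    setT measurableT (fun n x => (Q n x)%:E)
    (fun x => (cabs (fejerSum nu c d x) ^+ 2)%:E)
    (fun x => (2 * M)%:E *
      \sum_(0 <= k <oo) (cabs (c k) * tent d (nu k - x))%:E)%E.
  - by move=> n; exact: mQ.
  - exact: mF.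
  - by apply: aeW => x _; apply: cvg_EFin; [exact: nearW|exact: limQ].
  - exact: (integrable_tent_majorant nu _ d (2 * M) d0 M20 w0 sc).
  - apply: aeW => x n _; rewrite gee0_abs ?lee_fin//.
    apply: (@le_trans _ _ ((2 * M)%:E *
        \sum_(0 <= k < n) (cabs (c k) * tent d (nu k - x))%:E)%E).
      by rewrite sumEFin -EFinM lee_fin big_mkord; exact: tent_sqr_le.
    apply: lee_wpmul2l; first by rewrite lee_fin.
    apply: nneseries_lim_ge => k _ _.
    by rewrite lee_fin mulr_ge0// tent_ge0.
(* The segment [-L, L] depends on [n]; enlarging it to the whole line, harmless for a nonnegative
   integrand, makes the bound ready for the limit. *)
have PQ n : (\int[@lebesgue_measure R]_(t in `[(- T)%R, T]) (P n t)%:E <=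
    (C * d ^- 2)%:E * \int[@lebesgue_measure R]_x (Q n x)%:E)%E.
  have [L PL] := finite_gallagher n a b nu theta T d htheta0 htheta1 T0 dT.
  rewrite integral_segment_EFin//.
  apply: (@le_trans _ _ ((C * d ^- 2)%:E *
      \int[@lebesgue_measure R]_(x in `[(- L)%R, L]) (Q n x)%:E)%E).
    by rewrite integral_segment_EFin// -EFinM lee_fin.
  apply: lee_wpmul2l.
    by rewrite lee_fin mulr_ge0 ?invr_ge0 ?exprn_ge0// ltW.
  by apply: ge0_subset_integral => //; [exact: mQ|move=> x _; rewrite lee_fin].
rewrite muleA -EFinM.
have cvgCQ := @cvgeZl _ _ _ _ _ (C * d ^- 2)%:E isT cvgQ.
rewrite -(cvg_lim (@ereal_hausdorff R) cvgP) -(cvg_lim (@ereal_hausdorff R) cvgCQ).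
apply: lee_lim.
- by apply/cvg_ex; eexists; exact: cvgP.
- by apply/cvg_ex; eexists; exact: cvgCQ.
- exact: nearW.
Qed.
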